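(* For $\gamma>0$ let $(\bar u^\gamma,\bar z^\gamma)$, with $\bar u^\gamma=\boldsymbol S\bar z^\gamma$, be the solution of the regularized problem (P$^\gamma$). If $0\in Z_{ad}$ and $u_d\ge0$ a.e. in $\Omega$, then $$\|(\bar u^\gamma)_+\|_{L^2(\Omega)}=\mathcal O(\gamma^{-1})\quad\text{as }\gamma\to\infty.$$
   Context: Setting. $\Omega\subset\mathbb R^N$ ($N\ge1$) is a bounded Lipschitz domain satisfying the exterior cone condition, $0<s<1$, $\alpha>0$, $u_d\in L^2(\Omega)$, and $p$ is a real number with $2\le p<\infty$ and $p>N/(2s)$. $(w)_+=\max(w,0)$. $C_0(\Omega)$ is the space of continuous functions on $\overline\Omega$ vanishing on $\partial\Omega$. $\widetilde W^{s,2}_0(\Omega)=\{u\in W^{s,2}(\mathbb R^N): u=0\text{ in }\mathbb R^N\setminus\Omega\}$ and $$\mathcal E(u,v)=\frac{C_{N,s}}2\int_{\mathbb R^N}\int_{\mathbb R^N}\frac{(u(x)-u(y))(v(x)-v(y))}{|x-y|^{N+2s}}\,dx\,dy,\qquad C_{N,s}=\frac{s2^{2s}\Gamma(\frac{2s+N}{2})}{\pi^{N/2}\Gamma(1-s)} .$$ For $z\in Z:=L^p(\Omega)$, $\boldsymbol Sz\in\widetilde W^{s,2}_0(\Omega)\cap C_0(\Omega)$ denotes the unique weak solution of the fractional Dirichlet problem $(-\Delta)^su=z$ in $\Omega$, $u=0$ in $\mathbb R^N\setminus\Omega$, i.e. $\mathcal E(\boldsymbol Sz,v)=\int_\Omega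 zv$ for all $v\in\widetilde W^{s,2}_0(\Omega)$. $Z_{ad}\subset Z$ is nonempty, closed and convex. Problem (P$^\gamma$), $\gamma>0$ (Moreau-Yosida regularization of the state constraint $u\le 0$, i.e. the upper bound for the state is $u_b\equiv0$): for a fixed $\hat\mu\in L^2(\Omega)$ with $\hat\mu\ge0$ (independent of $\gamma$), minimize $\frac12\|\boldsymbol Sz-u_d\|_{L^2(\Omega)}^2+\frac\alpha2\|z\|_{L^2(\Omega)}^2+\frac1{2\gamma}\|(\hat\mu+\gamma\boldsymbol Sz)_+\|_{L^2(\Omega)}^2$ over $z\in Z_{ad}$. *)

(* Defs.v *)
From HB Require Import structures.
From mathcomp Require Import all_boot all_order all_algebra.
From mathcomp Require Import all_classical all_reals all_analysis.

Set Implicit Arguments.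
Unset Strict Implicit.
Unset Printing Implicit Defensive.
Import Order.TTheory GRing.Theory Num.Theory.
Import numFieldNormedType.Exports.

Local Open Scope classical_set_scope.
Local Open Scope ring_scope.

(* Makes the Landau notations available for limits at +oo in R. *)
Canonical pinfty_filter_on (R : numFieldType) :=
  FilterType (pinfty_nbhs R) _.

(* R^N is 'rV[R]_N, with the product (= Borel) sigma-algebra generated by the
   coordinate maps, as the library does for n.-tuple R. *)
Definition measure_rV_display : measure_display -> measure_display.
Proof. exact. Qed.

Section measurable_rV.
Context {R : realType} (n : nat).

Let coors : 'I_n -> 'rV[R]_n -> measurableTypeR R := fun i x => x 0 i.

Let rV_set0 : g_sigma_preimage coors set0.
Proof. exact: sigma_algebra0. Qed.

Let rV_setC A : g_sigma_preimage coors A -> g_sigma_preimage coors (~` A).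
Proof. exact: sigma_algebraC. Qed.

Let rV_bigcup (F : _^nat) : (forall i, g_sigma_preimage coors (F i)) ->
  g_sigma_preimage coors (\bigcup_i (F i)).
Proof. exact: sigma_algebra_bigcup. Qed.

HB.instance Definition _ := @isMeasurable.Build
  (measure_rV_display default_measure_display)
  'rV[R]_n (g_sigma_preimage coors) rV_set0 rV_setC rV_bigcup.

End measurable_rV.

Lemma measurable_coor (R : realType) n (i : 'I_n) :
  measurable_fun [set: 'rV[R]_n] (fun x => x 0 i : measurableTypeR R).
Proof.
move=> _ Y mY; rewrite setTI; apply: sub_sigma_algebra => /=.
rewrite -bigcup_seq/=; exists i => /=; first by rewrite mem_index_enum.
by exists Y => //; rewrite setTI.
Qed.

Lemma measurable_fun_rV d (T : measurableType d) (R : realType) n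
    (f : T -> 'rV[R]_n) :
  (forall i, measurable_fun [set: T] (fun t => f t 0 i : measurableTypeR R)) ->
  measurable_fun [set: T] f.
Proof.
move=> mf _ A mA; rewrite setTI.
suff: (<<s \big[setU/set0]_(i < n) preimage_set_system setT
    (fun x : 'rV[R]_n => x 0 i : measurableTypeR R) measurable >>
    `<=` image_set_system setT f measurable).
  by move=> /(_ A mA); rewrite /image_set_system/= setTI.
apply: smallest_sub.
  exact/sigma_algebra_image/sigma_algebra_measurable.
rewrite -bigcup_seq => B [i _] [C mC <-].
by rewrite /image_set_system /= setTI; exact: mf.
Qed.

Section cons_rV.
Context {R : realType} (n : nat).

Definition cons_rV (p : measurableTypeR R * 'rV[R]_n) : 'rV[R]_n.+1 :=
  \row_i (if unlift ord0 i is Some j then p.2 0 j else p.1).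

Lemma measurable_cons_rV : measurable_fun setT cons_rV.
Proof.
apply: measurable_fun_rV => i; rewrite /cons_rV.
under eq_fun do rewrite mxE.
case: unliftP => [j _|_]; last exact: measurable_fst.
exact: measurableT_comp (measurable_coor j) measurable_snd.
Qed.

Definition uncons_rV (x : 'rV[R]_n.+1) : measurableTypeR R * 'rV[R]_n :=
  (x 0 ord0, \row_j x 0 (lift ord0 j)).

Lemma measurable_uncons_rV : measurable_fun setT uncons_rV.
Proof.
apply/measurable_fun_pair; first exact: measurable_coor.
apply: measurable_fun_rV => i /=.
by under eq_fun do rewrite mxE; exact: measurable_coor.
Qed.

Lemma cons_rVK : cancel cons_rV uncons_rV.
Proof.
move=> [a x]; rewrite /uncons_rV /cons_rV mxE unlift_none/=; congr pair.
by apply/rowP => j; rewrite !mxE liftK.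
Qed.

End cons_rV.

Section lebesgue_step.
Local Open Scope ereal_scope.
Context {R : realType} (n : nat).
Variable m : {sigma_finite_measure set 'rV[R]_n -> \bar R}.

Definition lebesgue_step : set 'rV[R]_n.+1 -> \bar R :=
  pushforward (@lebesgue_measure R \x m) (@cons_rV R n).

Let mcons := @measurable_cons_rV R n.

Let step0 : lebesgue_step set0 = 0.
Proof. by rewrite /lebesgue_step /pushforward preimage_set0 measure0. Qed.

Let step_ge0 A : 0 <= lebesgue_step A.
Proof. exact: measure_ge0. Qed.

Let step_sigma_additive : semi_sigma_additive lebesgue_step.
Proof.
exact: (@measure_semi_sigma_additive _ _ _ (pushforward _ (@cons_rV R n))).
Qed.

HB.instance Definition _ := isMeasure.Build _ _ _ lebesgue_step
  step0 step_ge0 step_sigma_additive.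

Let step_sigma_finite : sigma_finite setT lebesgue_step.
Proof.
have /sigma_finiteP[F [TF ndF Foo]] := sigma_finiteT (@lebesgue_measure R).
have /sigma_finiteP[G [TG ndG Goo]] := sigma_finiteT m.
exists (fun k => @uncons_rV R n @^-1` (F k `*` G k)).
  rewrite -preimage_bigcup (_ : \bigcup_k _ = setT) ?preimage_setT//.
  apply/seteqP; split => // -[x y] _.
  have [k _ Fkx] : (\bigcup_i F i) x by rewrite -TF.
  have [l _ Gly] : (\bigcup_i G i) y by rewrite -TG.
  exists (maxn k l) => //; split.
    by move: x Fkx; exact/subsetPset/ndF/leq_maxl.
  by move: y Gly; exact/subsetPset/ndG/leq_maxr.
move=> k; have [mFk Fkoo] := Foo k; have [mGk Gkoo] := Goo k; split.
  rewrite -[X in measurable X]setTI.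
  by apply: measurable_uncons_rV => //; exact: measurableX.
rewrite /lebesgue_step /pushforward.
rewrite -comp_preimage (_ : _ \o _ = id); last exact/funext/cons_rVK.
by rewrite preimage_id product_measure1E// lte_mul_pinfty// ge0_fin_numE.
Qed.

HB.instance Definition _ := Measure_isSigmaFinite.Build _ _ _ lebesgue_step
  step_sigma_finite.

End lebesgue_step.

Fixpoint lebesgue_rV (R : realType) (n : nat) :
    {sigma_finite_measure set 'rV[R]_n -> \bar R} :=
  match n with
  | 0 => (\d_(0 : 'rV[R]_0))
  | n'.+1 => lebesgue_step (lebesgue_rV R n')
  end.

Lemma lebesgue_rV_box (R : realType) n (a b : 'rV[R]_n) :
  (forall i, a 0 i <= b 0 i) ->
  lebesgue_rV R n [set x | forall i, x 0 i \in `[a 0 i, b 0 i]%R] =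
  (\prod_(i < n) (b 0 i - a 0 i))%:E.
Proof.
elim: n a b => [|n IH] a b ab.
  rewrite big_ord0 /= /dirac indicE mem_set//= => -[]//.
pose a' : 'rV[R]_n := \row_j a 0 (lift ord0 j).
pose b' : 'rV[R]_n := \row_j b 0 (lift ord0 j).
rewrite /= /lebesgue_step /pushforward.
pose B := [set x : 'rV[R]_n | forall i, x 0 i \in `[a' 0 i, b' 0 i]].
have -> : @cons_rV R n @^-1` (fun x => forall i, x 0 i \in `[a 0 i, b 0 i]) =
    [set` `[a 0 ord0, b 0 ord0]] `*` B.
  apply/seteqP; split => -[x y] /=.
    move=> h; split; first by have := h ord0; rewrite mxE unlift_none.
    by move=> i; have := h (lift ord0 i); rewrite !mxE liftK.
  move=> [h1 h2] i; rewrite mxE; case: unliftP => [j ->|->//].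
  by have := h2 j; rewrite !mxE.
have mB : measurable B.
  rewrite (_ : B = \bigcap_(i in [set: 'I_n])
      ((fun x : 'rV[R]_n => x 0 i : measurableTypeR R) @^-1`
      [set` `[a' 0 i, b' 0 i]])); last first.
    by apply/seteqP; split => x /= h i; [move=> _; exact: h|exact: (h i I)].
  apply: fin_bigcap_measurable => // i _.
  by rewrite -[X in measurable X]setTI; exact: measurable_coor.
rewrite product_measure1E//.
rewrite [X in (_ * X)%E]IH; last by move=> i; rewrite !mxE.
rewrite /= lebesgue_measure_itv/= lte_fin big_ord_recl EFinM.
have -> : (\prod_(i < n) (b' 0 i - a' 0 i) =
  \prod_(i < n) (b 0 (lift ord0 i) - a 0 (lift ord0 i)))%R.
  by apply: eq_bigr => i _; rewrite !mxE.
have := ab ord0; rewrite le_eqVlt => /predU1P[->|ab0].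
  by rewrite ltxx subrr mul0e.
by rewrite ab0 EFinB.
Qed.

Section geometry.
Context {R : realType} {N : nat}.
Implicit Types (x y e : 'rV[R]_N) (Omega : set 'rV[R]_N).

(* The library norm `|x| on 'rV[R]_N is the sup norm; enorm is the Euclidean
   one. Both induce the same topology. *)
Definition dotrV x y : R := \sum_i x 0 i * y 0 i.

Definition enorm x : R := Num.sqrt (dotrV x x).

Definition boundary Omega : set 'rV[R]_N := closure Omega `\` interior Omega.

Definition domain Omega : Prop :=
  [/\ Omega !=set0, open Omega & connected Omega].

(* Near each boundary point x0, in some orthonormal coordinates y centred at
   x0, Omega is the strict epigraph of a Lipschitz function phi of the other
   N - 1 coordinates (a constant phi when N = 1). *)
Definition lipschitz_boundary Omega : Prop :=
  forall x0, boundary Omega x0 ->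
    exists (r : R) (Q : 'M[R]_N) (k : 'I_N) (phi : 'rV[R]_N.-1 -> R),
      [/\ 0 < r, Q *m Q^T = 1%:M, lipschitz (phi : _ -> R^o) &
        forall x, enorm (x - x0) < r ->
          let y := (x - x0) *m Q in
          Omega x <-> phi (col' k y) < y 0 k].

(* Finite closed right circular cone with vertex x0, axis e (a unit vector),
   opening half-angle arccos c, and height h. *)
Definition finite_cone x0 e (c h : R) : set 'rV[R]_N :=
  [set x | enorm (x - x0) <= h /\ c * enorm (x - x0) <= dotrV (x - x0) e].

Definition exterior_cone Omega : Prop :=
  forall x0, boundary Omega x0 ->
    exists e c h, [/\ enorm e = 1, 0 < c < 1, 0 < h &
      closure Omega `&` finite_cone x0 e c h = [set x0]].

Definition bounded_lipschitz_domain Omega : Prop :=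
  [/\ domain Omega, bounded_set Omega & lipschitz_boundary Omega].

End geometry.

Section function_spaces.
Context {R : realType} {N : nat}.
Implicit Types (Omega : set 'rV[R]_N) (u v f : 'rV[R]_N -> R).

Local Notation leb := (lebesgue_rV R N).

(* Elements of L^p(Omega) are represented by functions on R^N, of which only
   the values on Omega matter: f \_ Omega extends f by 0 outside Omega. *)
Definition Lp Omega (p : R) : set ('rV[R]_N -> R) :=
  [set f | f \_ Omega \in Lfun leb p%:E].

Definition Lpnorm Omega (p : R) f : R :=
  fine ('N[leb]_p%:E[EFin \o (f \_ Omega)])%E.

Definition Lp_closed Omega (p : R) (A : set ('rV[R]_N -> R)) : Prop :=
  forall (zn : nat -> 'rV[R]_N -> R) z, (forall n, A (zn n)) -> Lp Omega p z ->
    (fun n => Lpnorm Omega p (zn n \- z)) @ \oo --> (0 : R) -> A z.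

Definition convex_family (A : set ('rV[R]_N -> R)) : Prop :=
  forall z1 z2 (t : R), A z1 -> A z2 -> 0 <= t <= 1 ->
    A (fun x => (1 - t) * z1 x + t * z2 x).

(* At x = y the quotient is 0 / 0 = 0 (a null set). *)
Definition gagliardo (s : R) u v x y : R :=
  (u x - u y) * (v x - v y) / (enorm (x - y) `^ (N%:R + 2 * s)).

Definition Ws2 (s : R) : set ('rV[R]_N -> R) :=
  [set u | u \in Lfun leb 2%:E /\
    (\int[leb]_y \int[leb]_x (gagliardo s u u x y)%:E < +oo)%E].

Definition Ws2_0 Omega (s : R) : set ('rV[R]_N -> R) :=
  [set u | Ws2 s u /\ {ae leb, forall x, ~ Omega x -> u x = 0}].

Definition C_0 Omega : set ('rV[R]_N -> R) :=
  [set u | {within closure Omega, continuous u} /\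
    forall x, boundary Omega x -> u x = 0].

End function_spaces.

Definition Gamma {R : realType} (a : R) : R :=
  Rintegral (@lebesgue_measure R) `]0, +oo[%classic
    (fun t => t `^ (a - 1) * expR (- t)).

Definition C_Ns {R : realType} (N : nat) (s : R) : R :=
  s * 2 `^ (2 * s) * Gamma ((2 * s + N%:R) / 2) /
  (pi `^ (N%:R / 2) * Gamma (1 - s)).

Section optimal_control.
Context {R : realType} {N : nat}.
Implicit Types (Omega : set 'rV[R]_N) (u v z : 'rV[R]_N -> R).

Local Notation leb := (lebesgue_rV R N).

Definition energy (s : R) u v : \bar R :=
  ((C_Ns N s / 2)%:E *
    \int[leb]_y \int[leb]_x (gagliardo s u v x y)%:E)%E.

Definition weak_solution Omega (s : R) z u : Prop :=
  [/\ Ws2_0 Omega s u, C_0 Omega u &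
    forall v, Ws2_0 Omega s v ->
      energy s u v = (\int[leb]_(x in Omega) (z x * v x)%:E)%E].

(* The weak solution of the fractional Dirichlet problem with datum z. It is
   unique, pointwise on the closure of Omega and almost everywhere outside. *)
Definition solution_op Omega (s : R) z : 'rV[R]_N -> R :=
  xget (cst 0) [set u | weak_solution Omega s z u].

Definition reduced_cost Omega (s alpha : R) (ud muhat : 'rV[R]_N -> R)
    (gamma : R) z : R :=
  let Sz := solution_op Omega s z in
  2^-1 * Lpnorm Omega 2 (Sz \- ud) ^+ 2 +
  alpha / 2 * Lpnorm Omega 2 z ^+ 2 +
  (2 * gamma)^-1 *
    (Lpnorm Omega 2 (fun x => muhat x + gamma * Sz x)^\+) ^+ 2.

Definition is_solution_Pgamma Omega (s alpha : R) (ud muhat : 'rV[R]_N -> R)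
    (Zad : set ('rV[R]_N -> R)) (gamma : R) u z : Prop :=
  [/\ Zad z, u = solution_op Omega s z &
    forall z', Zad z' ->
      reduced_cost Omega s alpha ud muhat gamma z <=
      reduced_cost Omega s alpha ud muhat gamma z'].

End optimal_control.

(* Main.v *)
Require Import Defs.
From mathcomp Require Import all_boot all_order all_algebra.
From mathcomp Require Import all_classical all_reals all_analysis.
From mathcomp Require Import measurable_realfun ring lra.
Set Implicit Arguments.
Unset Strict Implicit.
Unset Printing Implicit Defensive.
Import Order.TTheory GRing.Theory Num.Theory.
Import numFieldNormedType.Exports.
Local Open Scope classical_set_scope.
Local Open Scope ring_scope.

(** The optimal control z is compared with the admissible control 0, whose state
    is 0. With g the regularization parameter, u the optimal state, d = ud >= 0
    and m = muhat >= 0, the inequality J(z) <= J(0) gives, once the control cost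
    of z is discarded,

      g |u - d|^2 + |(m + g u)_+|^2 <= g |d|^2 + |m|^2.

    The naive use of this inequality, which drops |u - d|^2, only yields the
    rate g^(-1/2). The gain comes from expanding |u - d|^2 - |d|^2: where u < 0
    the sign of d makes the difference nonnegative, and where u >= 0 it is at
    least -2 u d, which is linear in u and hence absorbed by the quadratic
    penalty at a cost of 2 d^2, without a factor g. This pointwise bound
    ([penalty_gap_ge]) integrates to

      g^2 / 2 * |(u)_+|^2 <= 2 |d|^2 + |m|^2,

    the asserted rate with an explicit constant ([state_positive_part_bound]).

    What needs care is the solution operator, which chooses one of the weak
    solutions, and takes the value 0 when there are none. In the latter case the
    bound for z is trivial. For the datum 0 a weak solution exists, and any of
    them, w, has zero energy, as one sees by testing with w itself. Since the
    constant C_Ns is positive, the Gagliardo integrand of w vanishes almost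
    everywhere, so w is almost everywhere constant; being 0 on the complement of
    the bounded set Omega, which has positive measure, it is 0 ([energy_eq0]).
    Positivity of C_Ns rests on the convergence of the integrals defining the
    Gamma function ([Gamma_integral_lty]). *)

(** * Positivity of the normalization constant *)

Lemma is_derive_inv_powR (R : realType) (a x : R) : 0 < x ->
  is_derive x (1 : R) (fun t => - (1 + t `^ a)^-1)
    (a * x `^ (a - 1) / (1 + x `^ a) ^+ 2).
Proof.
move=> x0.
have dp := @is_derive1_powR R a x x0.
have p0 : 1 + x `^ a != 0 by rewrite gt_eqF// ltr_pwDl// powR_ge0.
have dq : is_derive x (1 : R) (fun t => 1 + t `^ a) (a * x `^ (a - 1)).
  have : is_derive x (1 : R) (cst 1 + (@powR R)^~ a) (0 + a * x `^ (a - 1)).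
    exact: is_deriveD.
  by rewrite add0r.
have := is_deriveN (@is_deriveV _ (fun t : R => 1 + t `^ a) _ _ _ p0 dq).
rewrite /GRing.scale/= mulNr opprK mulrC; exact.
Qed.

(** A majorant with a bounded primitive: the right-hand side is K times the
    derivative of -1 / (1 + t^a), which stays in [-1, 0]. This treats the
    singularity at 0 and the tail at infinity at once. *)
Lemma Gamma_integrand_bound (R : realType) (a : R) : 0 < a ->
  exists K : R, forall x, 0 < x ->
    x `^ (a - 1) * expR (- x) <= K * (a * x `^ (a - 1) / (1 + x `^ a) ^+ 2).
Proof.
move=> a0; pose C : R := (2 * a) `^ a.
exists ((1 + C) ^+ 2 / a) => x x0.
have C0 : 0 <= C by exact: powR_ge0.
(* x / (2a) <= exp (x / (2a)), raised to the power a *)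
have xaC : x `^ a <= C * expR (x / 2).
  have a2 : 0 < 2 * a by rewrite mulr_gt0.
  have {1}-> : x = (2 * a) * (x / (2 * a)).
    by rewrite mulrCA divff ?mulr1// gt_eqF.
  rewrite powRM ?(ltW a2)//; last by rewrite divr_ge0 ?ltW.
  apply: ler_wpM2l => //.
  have -> : x / 2 = x / (2 * a) * a by rewrite invfM; field; rewrite gt_eqF.
  rewrite expRM ge0_ler_powR ?(ltW a0)// ?nnegrE ?expR_ge0//.
    by rewrite divr_ge0 ?ltW.
  by apply: le_trans (expR_ge1Dx _); rewrite lerDr.
have e1 : 1 <= expR (x / 2) by rewrite -[leLHS]expR0 ler_expR divr_ge0// ltW.
have p0 : 0 <= x `^ a by exact: powR_ge0.
have q0 : 0 < 1 + x `^ a by rewrite ltr_pwDl.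
have -> : (1 + C) ^+ 2 / a * (a * x `^ (a - 1) / (1 + x `^ a) ^+ 2) =
    x `^ (a - 1) * ((1 + C) ^+ 2 / (1 + x `^ a) ^+ 2).
  by field; rewrite !gt_eqF.
apply: ler_wpM2l; first exact: powR_ge0.
rewrite ler_pdivlMr ?exprn_gt0// expRN mulrC ler_pdivrMr ?expR_gt0//.
have -> : expR x = expR (x / 2) ^+ 2 by rewrite -expRM_natr divfK.
rewrite -exprMn lerXn2r ?nnegrE ?(ltW q0)//.
  by rewrite mulr_ge0 ?addr_ge0// expR_ge0.
by rewrite mulrDl mul1r lerD.
Qed.

Lemma continuous_powR (R : realType) (b x : R) : 0 < x ->
  {for x, continuous (fun t : R => t `^ b)}.
Proof.
move=> x0; apply: (@differentiable_continuous _ R^o R^o).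
by apply/derivable1_diffP; apply: ex_derive; exact: is_derive1_powR.
Qed.

Lemma measurable_Gamma_integrand (R : realType) (a : R) (D : set R) :
  measurable_fun D (fun t : R => t `^ (a - 1) * expR (- t)).
Proof.
apply: measurable_funTS; apply: measurable_funM.
  exact: measurable_powR.
by apply: measurableT_comp => //; exact: measurable_expR.
Qed.

(** On the compact intervals [1/(n+1), n+1] the fundamental theorem of calculus
    bounds the integral of the majorant independently of n; monotone convergence
    then passes to the half-line. *)
Lemma Gamma_integral_lty (R : realType) (a : R) : 0 < a ->
  (\int[@lebesgue_measure R]_(t in `]0%R, +oo[)
     (t `^ (a - 1) * expR (- t))%:E < +oo)%E.
Proof.
move=> a0; have [K HK] := Gamma_integrand_bound a0.
pose f (t : R) := t `^ (a - 1) * expR (- t).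
have f0 t : 0 <= f t by rewrite mulr_ge0 ?powR_ge0 ?expR_ge0.
have mf D : measurable_fun D (EFin \o f).
  by apply/measurable_EFinP; exact: measurable_Gamma_integrand.
pose F n : set R := `[n.+1%:R^-1, n.+1%:R]%classic.
have F0 n x : F n x -> 0 < x.
  by rewrite /F/= in_itv/= => /andP[+ _]; apply: lt_le_trans; rewrite invr_gt0.
have ndF : nondecreasing_seq F.
  move=> m n mn; apply/subsetPset => x; rewrite /F/= !in_itv/= => /andP[h1 h2].
  have mn' : (m.+1%:R <= n.+1%:R :> R) by rewrite ler_nat ltnS.
  rewrite (le_trans h2)// andbT (le_trans _ h1)// lef_pV2// ?posrE//.
have FE : `]0%R, +oo[%classic = \bigcup_i F i.
  apply/seteqP; split=> x /=; last by case=> n _ /F0; rewrite in_itv/= andbT.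
  rewrite in_itv/= andbT => x0.
  pose m := Num.truncn (x + x^-1); exists m => //.
  have xm : x + x^-1 < m.+1%:R by exact: truncnS_gt.
  have x'0 : 0 < x^-1 by rewrite invr_gt0.
  rewrite /F/= in_itv/= (_ : _ <= m.+1%:R)%R ?andbT; last first.
    by apply: ltW; apply: lt_trans xm; rewrite ltrDl.
  rewrite -[leRHS]invrK lef_pV2 ?posrE//.
  by apply: ltW; apply: lt_trans xm; rewrite ltrDr.
have bd n : (\int[@lebesgue_measure R]_(t in F n) (f t)%:E <= (`|K|)%:E)%E.
  have /andP[n1 nn] : (n.+1%:R^-1 <= 1 :> R) && (1 <= n.+1%:R :> R).
    by rewrite invf_le1// ler1n.
  pose g (x : R) : R := `|K| * (a * x `^ (a - 1) / (1 + x `^ a) ^+ 2).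
  have g0 x : 0 <= g x.
    rewrite /g mulr_ge0// divr_ge0//; last exact: sqr_ge0.
    by rewrite mulr_ge0 ?powR_ge0// ltW.
  pose G (x : R) : R := `|K| * - (1 + x `^ a)^-1.
  have dG (x : R) : 0 < x -> is_derive x (1 : R) G (g x).
    move=> x0; have := is_derive_inv_powR a x0.
    by move=> ?; exact: is_deriveZ.
  have cG (x : R) : 0 < x -> {for x, continuous G}.
    move=> x0; apply: (@differentiable_continuous _ R^o R^o).
    by apply/derivable1_diffP; apply: ex_derive; exact: dG.
  have dgx (x : R) : 0 < x -> {for x, continuous g}.
    move=> x0; apply: cvgM; first exact: cvg_cst.
    have cp b := @continuous_powR R b _ x0.
    apply: cvgM; first by apply: cvgM; [exact: cvg_cst|exact: cp].
    apply: cvgV; first by rewrite expf_neq0// gt_eqF// ltr_pwDl// powR_ge0.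
    by apply: cvgM; apply: cvgD; [exact: cvg_cst|exact: cp|exact: cvg_cst|exact: cp].
  have Hle : (\int[@lebesgue_measure R]_(t in F n) (f t)%:E <=
      \int[@lebesgue_measure R]_(t in F n) (g t)%:E)%E.
    apply: ge0_le_integral => //.
    - by rewrite /F; exact: measurable_itv.
    - by move=> x _; rewrite lee_fin.
    - exact: mf.
    - apply/measurable_EFinP; apply: subspace_continuous_measurable_fun.
        exact: measurable_itv.
      apply: continuous_in_subspaceT => x; rewrite inE => /F0.
      exact: dgx.
    - move=> x /F0 x0; rewrite lee_fin (le_trans (HK _ x0))// ler_wpM2r ?ler_norm//.
      rewrite divr_ge0 ?sqr_ge0// mulr_ge0 ?powR_ge0//; exact: ltW.
  apply: (le_trans Hle).
  have [n1'|n1'] := ltP (n.+1%:R^-1 : R) (n.+1%:R); last first.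
    rewrite /F (_ : n.+1%:R^-1 = n.+1%:R :> R); last first.
      by apply/eqP; rewrite eq_le n1' andbT (le_trans n1).
    by rewrite set_itv1 integral_set1 lee_fin.
  rewrite (@continuous_FTC2 _ g G)//.
  - rewrite -EFinB lee_fin /G !mulrN opprK -mulrN -mulrDr ler_piMr//.
    have q1 (x : R) : 0 <= (1 + x `^ a)^-1 <= 1.
      by rewrite invr_ge0 addr_ge0 ?powR_ge0//= invf_le1 ?lerDl
        ?ltr_pwDl ?powR_ge0.
    have /andP[_ q2] := q1 (n.+1%:R^-1); have /andP[q3 _] := q1 (n.+1%:R).
    by lra.
  - apply: continuous_in_subspaceT => x; rewrite inE => /F0; exact: dgx.
  - split.
    + move=> x; rewrite in_itv/= => /andP[h _]; apply: ex_derive; apply: dG.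
      by apply: lt_trans h; rewrite invr_gt0.
    + by apply: cvg_at_right_filter; apply: cG; rewrite invr_gt0.
    + by apply: cvg_at_left_filter; exact: cG.
  - move=> x; rewrite in_itv/= => /andP[h _]; rewrite derive1E.
    apply: derive_val; apply: dG.
    by apply: lt_trans h; rewrite invr_gt0.
rewrite FE; apply: (@le_lt_trans _ _ `|K|%:E); last exact: ltry.
have := @ge0_nondecreasing_set_cvg_integral _ (measurableTypeR R) _
  F (fun t => (f t)%:E) (@lebesgue_measure R) ndF.
move=> /(_ _ _ _)/cvg_lim <-//.
- apply: lime_le; last by near=> n; exact: bd.
  apply: ereal_nondecreasing_is_cvgn.
  apply: ge0_nondecreasing_set_nondecreasing_integral => //.
  + by move=> i; rewrite /F; exact: measurable_itv.
  + by move=> i; exact: mf.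
  + by move=> i x _; rewrite lee_fin.
- by move=> i; rewrite /F; exact: measurable_itv.
- by move=> i; exact: mf.
- by move=> i x _; rewrite lee_fin.
Unshelve. all: by end_near. Qed.

Lemma Gamma_gt0 (R : realType) (a : R) : 0 < a -> 0 < Gamma a.
Proof.
move=> a0; rewrite /Gamma /Rintegral fine_gt0// Gamma_integral_lty// andbT.
rewrite lt0e integral_ge0 ?andbT; last first.
  by move=> x _; rewrite lee_fin mulr_ge0 ?powR_ge0 ?expR_ge0.
apply/eqP => I0.
have : (\int[@lebesgue_measure R]_(x in `]0%R, +oo[)
    `|(x `^ (a - 1) * expR (- x))%:E| = 0)%E.
  rewrite -[RHS]I0; apply: eq_integral => x _.
  by rewrite gee0_abs// lee_fin mulr_ge0 ?powR_ge0 ?expR_ge0.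
move/ae_eq_integral_abs => /(_ (measurable_itv _)).
move=> /(_ _)[|N [mN N0 sN]].
  by apply/measurable_EFinP; exact: measurable_Gamma_integrand.
(* a vanishing integral would make ]0, 1[ a null set *)
have : (lebesgue_measure `]0%R, 1%R[%classic <= @lebesgue_measure R N)%E.
  apply: le_measure; rewrite ?inE//.
  move=> x /=; rewrite in_itv/= => /andP[x0 _]; apply: sN => /=.
  rewrite in_itv/= x0/= => /(_ isT) [] /eqP.
  by rewrite mulf_eq0 gt_eqF ?powR_gt0//= gt_eqF ?expR_gt0.
by rewrite N0 lebesgue_measure_itv/= lte_fin ltr01 sube0 lee_fin ler10.
Qed.

Lemma C_Ns_gt0 (R : realType) (N : nat) (s : R) : 0 < s < 1 -> 0 < C_Ns N s.
Proof.
move=> /andP[s0 s1]; rewrite /C_Ns.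
rewrite divr_gt0// mulr_gt0 ?Gamma_gt0 ?subr_gt0 ?powR_gt0 ?pi_gt0//.
- by rewrite mulr_gt0// powR_gt0.
- by rewrite divr_gt0// ltr_pwDl// mulr_gt0.
Qed.

(** * The pointwise inequality behind the rate *)

(** For u >= 0 the slack is 2 (g u / 2 - d)^2 plus nonnegative terms; for u < 0
    the tracking difference is nonnegative because d >= 0. *)
Lemma penalty_gap_ge (R : realType) (g u d m : R) :
  0 < g -> 0 <= d -> 0 <= m ->
  g ^+ 2 / 2 * Num.max u 0 ^+ 2 <=
    g * ((u - d) ^+ 2 - d ^+ 2) +
    (Num.max (m + g * u) 0 ^+ 2 - m ^+ 2) + (2 * d ^+ 2 + m ^+ 2).
Proof.
move=> g0 d0 m0; have [u0|u0] := leP 0 u.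
  have gu : 0 <= g * u by rewrite mulr_ge0// ltW.
  have mgu : 0 <= m * (g * u) by rewrite mulr_ge0.
  rewrite max_l ?addr_ge0//.
  have h1 := sqr_ge0 (g * u / 2 - d).
  have h2 : 0 <= g * u ^+ 2 by rewrite mulr_ge0 ?sqr_ge0// ltW.
  have h3 := sqr_ge0 m.
  have -> : g ^+ 2 / 2 * u ^+ 2 = (g * u) ^+ 2 / 2 by rewrite exprMn mulrAC.
  nra.
rewrite expr0n/= mulr0.
have h1 : 0 <= g * ((u - d) ^+ 2 - d ^+ 2).
  have -> : (u - d) ^+ 2 - d ^+ 2 = - u * (2 * d - u) by ring.
  rewrite mulr_ge0 ?(ltW g0)// mulr_ge0 ?oppr_ge0 ?(ltW u0)//; lra.
have h2 := sqr_ge0 (Num.max (m + g * u) 0).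
have h3 := sqr_ge0 d.
lra.
Qed.

(** * Integrating the penalty inequality *)

Section penalty.
Context {d} {T : measurableType d} {R : realType}.
Context (mu : {measure set T -> \bar R}).

Lemma Rintegral_ae_ge0 (f : T -> R) : mu.-integrable setT (EFin \o f) ->
  {ae mu, forall x, 0 <= f x} -> 0 <= Rintegral mu setT f.
Proof.
move=> If f0; have mf := measurable_int _ If.
rewrite /Rintegral (ae_eq_integral (fun x => `|(f x)%:E|)%E) //.
- by rewrite fine_ge0// integral_ge0.
- exact: measurableT_comp.
- by apply: filterS f0 => x fx _ /=; rewrite ger0_norm.
Qed.

Lemma integrable_sqr_funrpos (f : T -> R) : measurable_fun setT f ->
  mu.-integrable setT (fun x => (f x ^+ 2)%:E) ->
  mu.-integrable setT (fun x => (f^\+ x ^+ 2)%:E).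
Proof.
move=> mf; apply: le_integrable => //.
  by apply/measurable_EFinP/measurable_funX; exact: measurable_funrpos.
move=> x _; rewrite !gee0_abs ?lee_fin ?sqr_ge0//.
rewrite /funrpos; have [f0|f0] := leP (f x) 0; first by rewrite expr0n sqr_ge0.
exact: lexx.
Qed.

Lemma integrable_sqrD (f g : T -> R) (a b : R) :
  measurable_fun setT f -> measurable_fun setT g ->
  mu.-integrable setT (fun x => (f x ^+ 2)%:E) ->
  mu.-integrable setT (fun x => (g x ^+ 2)%:E) ->
  mu.-integrable setT (fun x => ((a * f x + b * g x) ^+ 2)%:E).
Proof.
move=> mf mg If Ig.
have I2 : mu.-integrable setT
    (fun x => ((2 * a ^+ 2)%:E * (f x ^+ 2)%:E + (2 * b ^+ 2)%:E * (g x ^+ 2)%:E)%E).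
  by apply: integrableD => //; exact: integrableZl.
apply: le_integrable I2 => //.
  apply/measurable_EFinP/measurable_funX/measurable_funD;
    by apply: measurable_funM.
move=> x _; rewrite -!EFinM -EFinD !gee0_abs ?lee_fin ?sqr_ge0//.
  have := sqr_ge0 (a * f x - b * g x); nra.
by rewrite addr_ge0// mulr_ge0 ?sqr_ge0// mulr_ge0 ?sqr_ge0.
Qed.

Lemma penalty_estimate (g : R) (u ud m : T -> R) : 0 < g ->
  measurable_fun setT u -> measurable_fun setT ud -> measurable_fun setT m ->
  mu.-integrable setT (fun x => (u x ^+ 2)%:E) ->
  mu.-integrable setT (fun x => (ud x ^+ 2)%:E) ->
  mu.-integrable setT (fun x => (m x ^+ 2)%:E) ->
  {ae mu, forall x, 0 <= ud x} -> {ae mu, forall x, 0 <= m x} ->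
  g * Rintegral mu setT (fun x => (u x - ud x) ^+ 2) +
    Rintegral mu setT (fun x => (fun x => m x + g * u x)^\+ x ^+ 2) <=
  g * Rintegral mu setT (fun x => ud x ^+ 2) +
    Rintegral mu setT (fun x => m x ^+ 2) ->
  g ^+ 2 / 2 * Rintegral mu setT (fun x => u^\+ x ^+ 2) <=
  2 * Rintegral mu setT (fun x => ud x ^+ 2) + Rintegral mu setT (fun x => m x ^+ 2).
Proof.
move=> g0 mu_ md mm Iu Id Im d0 m0 H.
have I1 : mu.-integrable setT (fun x => ((u x - ud x) ^+ 2)%:E).
  have := integrable_sqrD 1 (-1) mu_ md Iu Id.
  by apply: eq_integrable => // x _; rewrite mul1r mulN1r.
have I2 : mu.-integrable setT
    (fun x => ((fun x => m x + g * u x)^\+ x ^+ 2)%:E).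
  apply: integrable_sqr_funrpos.
    by apply: measurable_funD => //; exact: measurable_funM.
  have := integrable_sqrD 1 g mm mu_ Im Iu.
  by apply: eq_integrable => // x _; rewrite mul1r.
have Ip := integrable_sqr_funrpos mu_ Iu.
have J1 : mu.-integrable setT (EFin \o (fun x =>
    (u x - ud x) ^+ 2 - ud x ^+ 2)).
  by have := integrableB measurableT I1 Id; apply: eq_integrable.
have J2 : mu.-integrable setT (EFin \o (fun x =>
    g * ((u x - ud x) ^+ 2 - ud x ^+ 2))).
  by have := integrableZl measurableT g J1; apply: eq_integrable.
have J3 : mu.-integrable setT (EFin \o (fun x =>
    (fun x => m x + g * u x)^\+ x ^+ 2 - m x ^+ 2)).
  by have := integrableB measurableT I2 Im; apply: eq_integrable.
have J4 := integrableD measurableT J2 J3.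
have J5 : mu.-integrable setT (EFin \o (fun x => 2 * ud x ^+ 2)).
  by have := integrableZl measurableT 2 Id; apply: eq_integrable.
have J6 : mu.-integrable setT (EFin \o (fun x => 2 * ud x ^+ 2 + m x ^+ 2)).
  by have := integrableD measurableT J5 Im; apply: eq_integrable.
have J7 := integrableD measurableT J4 J6.
have J8 : mu.-integrable setT (EFin \o (fun x => g ^+ 2 / 2 * u^\+ x ^+ 2)).
  by have := integrableZl measurableT (g ^+ 2 / 2) Ip; apply: eq_integrable.
have := Rintegral_ae_ge0 (integrableB measurableT J7 J8).
rewrite !(RintegralB, RintegralD, RintegralZl)// => /(_ _) h.
suff : {ae mu, forall x, 0 <= g * ((u x - ud x) ^+ 2 - ud x ^+ 2) +
    ((fun x => m x + g * u x)^\+ x ^+ 2 - m x ^+ 2) +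
    (2 * ud x ^+ 2 + m x ^+ 2) - g ^+ 2 / 2 * u^\+ x ^+ 2} by move/h; lra.
apply: filterS2 d0 m0 => x dx mx; rewrite subr_ge0.
exact: penalty_gap_ge.
Qed.

End penalty.

(** * Measure-theoretic preliminaries *)

Lemma Lfun2P d (T : measurableType d) (R : realType)
    (mu : {measure set T -> \bar R}) (f : T -> R) :
  f \in Lfun mu 2%:E <->
  measurable_fun setT f /\ mu.-integrable setT (fun x => (f x ^+ 2)%:E).
Proof.
split=> [lf|[mf If]].
  split; last exact: Lfun2_integrable_sqr.
  by move: lf; rewrite inE => /andP[]; rewrite inE.
rewrite inE; apply/andP; split; rewrite inE//=.
rewrite /finite_norm unlock poweR_lty//.
have /integrableP[_] := If; apply: le_lt_trans.
rewrite le_eqVlt; apply/orP; left; apply/eqP; apply: eq_integral => x _.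
by rewrite /= powR_mulrn// real_normK ?num_real// ger0_norm// sqr_ge0.
Qed.

Lemma ae_exists_in d (T : measurableType d) (R : realType)
    (mu : {measure set T -> \bar R}) (A : set T) (P : T -> Prop) :
  measurable A -> (0 < mu A)%E -> {ae mu, forall x, P x} ->
  exists2 x, A x & P x.
Proof.
move=> mA A0 [N [mN N0 sN]]; apply: contrapT => h.
have : (mu A <= mu N)%E.
  by apply: le_measure; rewrite ?inE// => x Ax; apply: sN => /= Px; apply: h; exists x.
by rewrite N0 leNgt A0.
Qed.

Section space.
Context {R : realType} {N : nat}.
Local Notation leb := (lebesgue_rV R N).
Implicit Types (Omega : set 'rV[R]_N) (u v z : 'rV[R]_N -> R).

(** Both sides apply [fine] to the same extended integral, so that the identity
    also covers infinite norms. *)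
Lemma Lpnorm2_sqr Omega u :
  Lpnorm Omega 2 u ^+ 2 = Rintegral leb setT (fun x => (u \_ Omega) x ^+ 2).
Proof.
rewrite /Lpnorm -powR_mulrn ?fine_ge0 ?Lnorm_ge0// -fine_poweR poweR_Lnorm//.
rewrite /Rintegral; congr fine; apply: eq_integral => x _.
by rewrite /= powR_mulrn// real_normK ?num_real.
Qed.

Lemma measurable_coor_box (a b : 'rV[R]_N) :
  measurable [set x : 'rV[R]_N | forall i, x 0 i \in `[a 0 i, b 0 i]%R].
Proof.
rewrite (_ : mkset _ = \bigcap_(i in [set: 'I_N])
  ((fun x : 'rV[R]_N => x 0 i : measurableTypeR R) @^-1`
      [set` `[a 0 i, b 0 i]])); last first.
  by apply/seteqP; split => x /= h i; [move=> _; exact: h|exact: (h i I)].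
apply: fin_bigcap_measurable => // i _.
by rewrite -[X in measurable X]setTI; exact: measurable_coor.
Qed.

(** The sigma-algebra is generated by the coordinates, so an open set is written
    as a countable union of closed boxes with rational corners. *)
Lemma measurable_open Omega : open Omega -> measurable Omega.
Proof.
move=> oO.
pose box (q : 'rV[rat]_N * 'rV[rat]_N) := [set x : 'rV[R]_N |
  forall i, x 0 i \in `[(map_mx ratr q.1 : 'rV[R]_N) 0 i,
                        (map_mx ratr q.2 : 'rV[R]_N) 0 i]%R].
pose F q := if `[< box q `<=` Omega >] then box q else set0.
have -> : Omega = \bigcup_q F q; last first.
  apply: countable_bigcupT_measurable => [|q]; first exact: countableP.
  by rewrite /F; case: ifPn => // _; exact: measurable_coor_box.
apply/seteqP; split=> [x Ox|x [q _]]; last first.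
  by rewrite /F; case: ifPn => [/asboolP|_ []]; exact.
have /nbhs_ballP[e/= e0 eO] : nbhs x Omega by exact: open_nbhs_nbhs.
have lo i : {q : rat | ratr q \in `](x 0 i - e), (x 0 i)[}.
  by apply: cid; have [|q] := @rat_in_itvoo R (x 0 i - e) (x 0 i);
    [rewrite ltrBlDr ltrDl|exists q].
have hi i : {q : rat | ratr q \in `](x 0 i), (x 0 i + e)[}.
  by apply: cid; have [|q] := @rat_in_itvoo R (x 0 i) (x 0 i + e);
    [rewrite ltrDl|exists q].
pose q : 'rV[rat]_N * 'rV[rat]_N := (\row_i sval (lo i), \row_i sval (hi i)).
exists q => //; rewrite /F asboolT.
  move=> i; rewrite !mxE/=.
  have := svalP (lo i); have := svalP (hi i); rewrite !in_itv/=.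
  by move=> /andP[h _] /andP[_ h']; rewrite !ltW.
move=> y yb; apply: eO; rewrite /ball/= /mx_ball; split=> // i0 i.
have := yb i; rewrite !mxE/= !in_itv/= => /andP[y1 y2].
have := svalP (lo i); have := svalP (hi i); rewrite !in_itv/=.
move=> /andP[h1 h2] /andP[h3 h4]; rewrite (ord1 i0) /ball/= ltr_norml.
by apply/andP; split; lra.
Qed.

(** Dimension 0 must be excluded, as the only point may then lie in Omega. *)
Lemma bounded_complement_box Omega : (0 < N)%N -> bounded_set Omega ->
  exists B : set 'rV[R]_N, [/\ measurable B, (0 < leb B)%E & B `<=` ~` Omega].
Proof.
move=> N0 [M [_ bO]]; pose c := `|M| + 1.
pose a : 'rV[R]_N := const_mx (c + 1); pose b : 'rV[R]_N := const_mx (c + 2).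
exists [set x : 'rV[R]_N | forall i, x 0 i \in `[a 0 i, b 0 i]%R]; split.
- exact: measurable_coor_box.
- rewrite lebesgue_rV_box; last by move=> i; rewrite !mxE lerD2l ler1n.
  by rewrite lte_fin prodr_gt0// => i _; rewrite !mxE; lra.
- move=> x xB Ox; have := bO c _ x Ox.
  rewrite (@le_lt_trans _ _ `|M|) ?ler_norm ?ltrDl// => /(_ isT).
  have := xB (Ordinal N0); rewrite in_itv/= mxE => /andP[xc _].
  have : `|x 0 (Ordinal N0)| <= `|x|.
    rewrite [leRHS]/Num.norm/= mx_normrE.
    exact: (le_bigmax _ (fun ij => `|x ij.1 ij.2|) (0, Ordinal N0)).
  have := ler_norm (x 0 (Ordinal N0)); lra.
Qed.

(** * Functions of zero energy *)

Lemma enorm_eq0 (x : 'rV[R]_N) : enorm x = 0 -> x = 0.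
Proof.
have d0 : 0 <= dotrV x x by apply: sumr_ge0 => i _; rewrite -expr2 sqr_ge0.
move=> /eqP; rewrite /enorm sqrtr_eq0 => d1.
have /eqP : dotrV x x = 0 by apply/eqP; rewrite eq_le d1.
rewrite psumr_eq0 => [/allP h|i _]; last by rewrite -expr2 sqr_ge0.
apply/rowP => i; rewrite mxE; have := h i; rewrite mem_index_enum => /(_ isT).
by rewrite -expr2 sqrf_eq0 => /eqP.
Qed.

Lemma measurable_enorm_sub :
  measurable_fun setT (fun p : 'rV[R]_N * 'rV[R]_N => enorm (p.1 - p.2)).
Proof.
apply: (@measurableT_comp _ _ _ _ _ _ (@Num.sqrt R)).
  by apply: continuous_measurable_fun; exact: sqrt_continuous.
apply: measurable_sum => i; under eq_fun do rewrite !mxE.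
have mc : measurable_fun setT (fun p : 'rV[R]_N * 'rV[R]_N => p.1 0 i - p.2 0 i).
  by apply: measurable_funB;
    [exact: (measurableT_comp (measurable_coor i) measurable_fst)
    |exact: (measurableT_comp (measurable_coor i) measurable_snd)].
exact: measurable_funM.
Qed.

Lemma measurable_gagliardo (s : R) u v :
  measurable_fun setT u -> measurable_fun setT v ->
  measurable_fun setT
    (fun p : 'rV[R]_N * 'rV[R]_N => (gagliardo s u v p.1 p.2)%:E).
Proof.
move=> mu mv; apply/measurable_EFinP; rewrite /gagliardo.
under eq_fun do rewrite -powRN.
have md (w : 'rV[R]_N -> R) : measurable_fun setT w ->
    measurable_fun setT (fun p : 'rV[R]_N * 'rV[R]_N => w p.1 - w p.2).
  by move=> mw; apply: measurable_funB;
    [exact: (measurableT_comp mw measurable_fst)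
    |exact: (measurableT_comp mw measurable_snd)].
apply: measurable_funM; first by apply: measurable_funM; exact: md.
apply: (@measurableT_comp _ _ _ _ _ _ (@powR R ^~ _)) => //.
exact: measurable_enorm_sub.
Qed.

Lemma gagliardo_ge0 (s : R) u x y : 0 <= gagliardo s u u x y.
Proof. by rewrite divr_ge0 ?powR_ge0// -expr2 sqr_ge0. Qed.

(** Fubini gives, for almost every y, w x = w y for almost every x; choosing
    such a y in the complement of Omega, where w y = 0, yields the claim. *)
Lemma energy_eq0 Omega (s : R) w : (0 < N)%N -> bounded_set Omega -> 0 < s < 1 ->
  Ws2_0 Omega s w -> energy s w w = 0%E -> {ae leb, forall x, w x = 0}.
Proof.
move=> N0 bO s01 [[/Lfun2P[mw _] _] w0].
have mg := measurable_gagliardo s mw mw.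
have g0 p : (0 <= (gagliardo s w w p.1 p.2)%:E)%E by rewrite lee_fin gagliardo_ge0.
move=> /eqP; rewrite /energy mule_eq0 eqe gt_eqF/= => [/eqP I0|]; last first.
  by rewrite divr_gt0// C_Ns_gt0.
pose G y := (\int[leb]_x (gagliardo s w w x y)%:E)%E.
have mG : measurable_fun setT G.
  exact: (@measurable_fun_fubini_tonelli_G _ _ _ _ _ leb _ mg g0).
have G0 : {ae leb, forall y, G y = 0%E}.
  have /(ae_eq_integral_abs _ measurableT mG) :
      (\int[leb]_y `|G y| = 0)%E.
    rewrite -[RHS]I0; apply: eq_integral => y _; rewrite gee0_abs//.
    by apply: integral_ge0 => x _; exact: (g0 (x, y)).
  by apply: filterS => y; exact.
have [B [mB B0 BO]] := bounded_complement_box N0 bO.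
have [y By [Gy wy]] : exists2 y, B y & G y = 0%E /\ (~ Omega y -> w y = 0).
  by apply: ae_exists_in mB B0 _; apply: filterS2 G0 w0.
have {}wy : w y = 0 by apply: wy; exact: BO.
have my : measurable_fun setT (fun x => (gagliardo s w w x y)%:E).
  exact: (measurableT_comp mg (measurable_pair2 y)).
have /(ae_eq_integral_abs _ measurableT my) :
    (\int[leb]_x `|(gagliardo s w w x y)%:E| = 0)%E.
  rewrite -[RHS]Gy; apply: eq_integral => x _.
  by rewrite gee0_abs//; exact: (g0 (x, y)).
apply: filterS => x /(_ Logic.I) [] /eqP.
rewrite /gagliardo wy subr0 mulf_eq0 mulf_eq0 orbb invr_eq0 powR_eq0 => /orP[/eqP//|].
by move=> /andP[/eqP/enorm_eq0/eqP]; rewrite subr_eq0 => /eqP ->.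
Qed.

(** The zero function is a weak solution, so the chosen one is too; testing its
    equation with itself shows that it has zero energy. *)
Lemma solution_op0 Omega (s : R) :
  (0 < N)%N -> bounded_set Omega -> 0 < s < 1 ->
  weak_solution Omega s (cst 0) (solution_op Omega s (cst 0)) /\
  {ae leb, forall x, solution_op Omega s (cst 0) x = 0}.
Proof.
move=> N0 bO s01.
have w0 : weak_solution Omega s (cst 0) (cst 0).
  have I0 v : (\int[leb]_y \int[leb]_x (gagliardo s (cst 0%R) v x y)%:E = 0)%E.
    rewrite integral0_eq// => y _; rewrite integral0_eq// => x _.
    by rewrite /gagliardo/= subr0 !mul0r.
  split.
  - split; last by apply/nearW.
    split; last by rewrite I0 ltry.
    apply/Lfun2P; split; first exact: measurable_cst.
    by under eq_fun do rewrite expr0n; exact: integrable0.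
  - by split=> // x; exact: cvg_cst.
  - move=> v _; rewrite /energy I0 mule0 integral0_eq// => x _.
    by rewrite /= mul0r.
have hw : weak_solution Omega s (cst 0) (solution_op Omega s (cst 0)).
  by apply: (@xgetPex _ (cst 0) (weak_solution Omega s (cst 0))); exists (cst 0).
split=> //; have [hw0 _ ew] := hw; apply: (energy_eq0 N0 bO s01 hw0).
by rewrite (ew _ hw0); apply: integral0_eq => x _; rewrite /= mul0r.
Qed.

(** * The bound on the positive part of the state *)

Lemma patch_map2 Omega (h : R -> R -> R) u v : h 0 0 = 0 ->
  (fun x => h (u x) (v x)) \_ Omega =
  (fun x => h ((u \_ Omega) x) ((v \_ Omega) x)).
Proof. by move=> h0; apply/funext => x; rewrite !patchE; case: ifPn. Qed.

Lemma Lpnorm2_sqr_ae Omega u v :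
  measurable_fun setT (u \_ Omega) -> measurable_fun setT (v \_ Omega) ->
  {ae leb, forall x, Omega x -> u x ^+ 2 = v x ^+ 2} ->
  Lpnorm Omega 2 u ^+ 2 = Lpnorm Omega 2 v ^+ 2.
Proof.
move=> mu mv uv; rewrite !Lpnorm2_sqr /Rintegral; congr fine.
apply: ae_eq_integral => //.
- exact/measurable_EFinP/measurable_funX.
- exact/measurable_EFinP/measurable_funX.
- apply: filterS uv => x uvx _; rewrite !patchE; case: ifPn => // xO.
  by congr EFin; apply: uvx; move: xO; rewrite inE.
Qed.

(** The constant depends on neither the optimal control nor g, which is what turns
    a bound for each g into a rate. *)
Lemma state_positive_part_bound Omega (s alpha g : R) ud muhat Zad u z :
  (0 < N)%N -> open Omega -> bounded_set Omega -> 0 < s < 1 -> 0 < alpha ->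
  0 < g -> Lp Omega 2 ud -> Lp Omega 2 muhat ->
  {ae leb, forall x, Omega x -> 0 <= muhat x} ->
  {ae leb, forall x, Omega x -> 0 <= ud x} -> Zad (cst 0) ->
  is_solution_Pgamma Omega s alpha ud muhat Zad g u z ->
  g ^+ 2 / 2 * Lpnorm Omega 2 u^\+ ^+ 2 <=
    2 * Lpnorm Omega 2 ud ^+ 2 + Lpnorm Omega 2 muhat ^+ 2.
Proof.
move=> N0 oO bO s01 a0 g0 Lud Lmu mu0 ud0 Z0 [_ -> minz].
have mO := measurable_open oO.
have /Lfun2P[mud Iud] := Lud; have /Lfun2P[mmu Imu] := Lmu.
set S := solution_op Omega s z.
(* without a weak solution the state is 0 by definition *)
have [[w hw]|none] := pselect (exists w, weak_solution Omega s z w); last first.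
  have -> : S = cst 0.
    by apply: xgetPN => w hw; apply: none; exists w.
  rewrite [X in _ * X <= _]Lpnorm2_sqr /Rintegral.
  under eq_integral do rewrite patchE /funrpos maxxx if_same expr0n/=.
  by rewrite integral0 mulr0 addr_ge0 ?sqr_ge0// mulr_ge0 ?sqr_ge0.
have [[[/Lfun2P[mS IS] _] _] _ _] : weak_solution Omega s z S.
  by apply: (@xgetPex _ (cst 0) (weak_solution Omega s z)); exists w.
have patch_measurable (f : 'rV[R]_N -> R) : measurable_fun setT f ->
    measurable_fun setT (f \_ Omega).
  by move=> mf; apply/(measurable_restrictT _ mO)/measurable_funTS.
have mS' := patch_measurable _ mS.
have IS' : leb.-integrable setT (fun x => ((S \_ Omega) x ^+ 2)%:E).
  apply: le_integrable IS => //; first exact/measurable_EFinP/measurable_funX.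
  move=> x _; rewrite !gee0_abs ?lee_fin ?sqr_ge0// patchE.
  by case: ifPn => // _; rewrite expr0n sqr_ge0.
(* All functions are extended by 0 outside Omega, which commutes with the maps
   forming the cost because these send zero arguments to 0. *)
have sub0 : (0 : R) - 0 = 0 by rewrite subr0.
have max0 : Num.max (0 + g * 0 : R) 0 = 0 by rewrite mulr0 addr0 maxxx.
have P1 v := @patch_map2 Omega (fun a b => a - b) v ud sub0.
have P2 v := @patch_map2 Omega (fun b a => Num.max (b + g * a) 0) muhat v max0.
have P3 : S^\+ \_ Omega = (S \_ Omega)^\+.
  exact: (@patch_map2 Omega (fun a _ => Num.max a 0) S S (maxxx 0)).
have ae_patch (f : 'rV[R]_N -> R) : {ae leb, forall x, Omega x -> 0 <= f x} ->
    {ae leb, forall x, 0 <= (f \_ Omega) x}.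
  apply: filterS => x fx; rewrite patchE; case: ifPn => // xO.
  by apply: fx; move: xO; rewrite inE.
have := minz _ Z0; rewrite /reduced_cost -/S.
set S0 := solution_op _ _ _.
have := solution_op0 N0 bO s01; rewrite -/S0 => -[[[[/Lfun2P[mS0 _] _] _] _ _] S00].
have mS0' := patch_measurable _ mS0.
have E1 : Lpnorm Omega 2 (S0 \- ud) ^+ 2 = Lpnorm Omega 2 ud ^+ 2.
  apply: Lpnorm2_sqr_ae => //; first by rewrite P1; exact: measurable_funB.
  by apply: filterS S00 => x /= -> _; rewrite sub0r sqrrN.
have E2 : Lpnorm Omega 2 (fun x => muhat x + g * S0 x)^\+ ^+ 2 =
    Lpnorm Omega 2 muhat ^+ 2.
  apply: Lpnorm2_sqr_ae => //.
    rewrite /funrpos P2; apply: measurable_maxr => //.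
    by apply: measurable_funD => //; exact: measurable_funM.
  apply: filterS2 S00 mu0 => x Sx mx Ox.
  by rewrite /funrpos Sx mulr0 addr0 max_l// mx.
have E3 : Lpnorm Omega 2 (cst 0) ^+ 2 = 0.
  rewrite Lpnorm2_sqr /Rintegral.
  under eq_integral do rewrite patchE if_same expr0n/=.
  by rewrite integral0.
rewrite E1 E2 E3 mulr0 addr0.
have := penalty_estimate g0 mS' mud mmu IS' Iud Imu (ae_patch _ ud0) (ae_patch _ mu0).
have Z2 : 0 <= alpha / 2 * Lpnorm Omega 2 z ^+ 2.
  by rewrite mulr_ge0 ?sqr_ge0// divr_ge0// ltW.
rewrite !Lpnorm2_sqr in Z2 *; rewrite P3 /funrpos P1 P2.
set A := Rintegral _ _ _; set B := Rintegral _ _ _.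
set C := Rintegral _ _ _; set D := Rintegral _ _ _.
move=> est ineq; apply: est.
(* multiplying by 2 g puts the cost inequality in the form of penalty_estimate *)
have : g * 2 * (2^-1 * A + (2 * g)^-1 * B) <= g * 2 * (2^-1 * C + (2 * g)^-1 * D).
  by rewrite ler_pM2l ?mulr_gt0//; lra.
suff E x y : g * 2 * (2^-1 * x + (2 * g)^-1 * y) = g * x + y by rewrite !E.
by field; rewrite gt_eqF.
Qed.

End space.

Theorem theorem4p2 (R : realType) (N : nat) (Omega : set 'rV[R]_N)
    (s alpha p : R) (ud muhat : 'rV[R]_N -> R) (Zad : set ('rV[R]_N -> R))
    (ubar zbar : R -> 'rV[R]_N -> R) :
  (1 <= N)%N ->
  bounded_lipschitz_domain Omega -> exterior_cone Omega ->
  0 < s < 1 -> 0 < alpha ->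
  2 <= p -> N%:R / (2 * s) < p ->
  Lp Omega 2 ud ->
  Lp Omega 2 muhat ->
  {ae lebesgue_rV R N, forall x, Omega x -> 0 <= muhat x} ->
  Zad `<=` Lp Omega p -> Zad !=set0 -> Lp_closed Omega p Zad ->
  convex_family Zad ->
  (forall gamma : R, 0 < gamma ->
    is_solution_Pgamma Omega s alpha ud muhat Zad gamma
      (ubar gamma) (zbar gamma)) ->
  Zad (cst 0) ->
  {ae lebesgue_rV R N, forall x, Omega x -> 0 <= ud x} ->
  (fun gamma : R => Lpnorm Omega 2 (ubar gamma)^\+ : R^o)
    =O_ (pinfty_nbhs R) (fun gamma : R => gamma^-1 : R^o).
Proof.
move=> N0 [[_ oO _] bO _] _ s01 a0 _ _ Lud Lmu mu0 _ _ _ _ sol Z0 ud0.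
set K := 2 * Lpnorm Omega 2 ud ^+ 2 + Lpnorm Omega 2 muhat ^+ 2.
have K0 : 0 <= K by rewrite addr_ge0 ?sqr_ge0// mulr_ge0 ?sqr_ge0.
apply/eqOP; near=> k.
(* the norm times g is at most sqrt (2 K) <= K + 1 *)
have k1 : K + 1 <= k by near: k; apply: nbhs_pinfty_ge; exact: num_real.
near=> g.
have g0 : 0 < g by near: g; exact: nbhs_pinfty_gt.
have X0 : 0 <= Lpnorm Omega 2 (ubar g)^\+ by rewrite fine_ge0// Lnorm_ge0.
rewrite ger0_norm// ger0_norm ?invr_ge0 ?(ltW g0)// ler_pdivlMr//.
have bd := state_positive_part_bound N0 oO bO s01 a0 g0 Lud Lmu mu0 ud0 Z0
  (sol g g0).
have k0 : 0 <= k by apply: le_trans k1; rewrite addr_ge0.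
rewrite -(@ler_pXn2r _ 2)// ?nnegrE ?mulr_ge0 ?(ltW g0)//.
apply: (@le_trans _ _ (2 * K)).
  by move: bd; rewrite exprMn -/K; move: (Lpnorm _ _ _) => X; lra.
have : (K + 1) * (K + 1) <= k * k by apply: ler_pM; lra.
rewrite expr2; have := sqr_ge0 K; lra.
Unshelve. all: by end_near. Qed.
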